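(* Let $f=h+\overline{g}$ be a polynomial harmonic function, where $h$ and $g$ are polynomials, each of degree at least $2$. Then $f$ has an $\mathfrak{h}$-fixed point $\zeta=\mu+\overline{\omega}$ whose multipliers $\lambda=\partial_z h(\mu)$ and $\theta=\partial_z g(\omega)$ satisfy $\operatorname{Re}(\lambda)\ge 1$ and $\operatorname{Re}(\theta)\ge 1$.
   Context: Here $\overline{g}$ denotes the function $z\mapsto\overline{g(z)}$. A harmonic function $f=h+\overline{g}$ is called a polynomial harmonic function if both $h$ and $g$ are polynomials of degree at least $2$. $\mathfrak{h}$-fixed points: a finite $\mathfrak{h}$-fixed point of $f=h+\overline{g}$ is a complex number $\zeta=\mu+\overline{\omega}$, with $\mu,\omega\in\mathbb{C}$, such that $\mu+\overline{\omega}=h(\mu)+\overline{g(\omega)}$. Infinite $\mathfrak{h}$-fixed points are the formal expressions: $\mu+\overline{\infty}$ if $h(\mu)=\mu$ and $g(\infty)=\infty$; $\infty+\overline{\omega}$ if $h(\infty)=\infty$ and $g(\omega)=\omega$; $\infty+\overline{\infty}$ if $h(\infty)=\infty$ and $g(\infty)=\infty$. The multipliers of an $\mathfrak{h}$-fixed point $\mu+\overline{\omega}$ are $\lambda=\partial_z h(\mu)=h'(\mu)$ and $\theta=\partial_z g(\omega)=g'(\omega)$; for a fixed point at $\infty$ of a rational function $R$, the multiplier is the derivative at $0$ of $z\mapsto 1/R(1/z)$. *)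

(* Defs.v *)
From HB Require Import structures.
From mathcomp Require Export all_boot all_order all_algebra.
From mathcomp Require Export all_classical all_reals all_analysis.
From mathcomp Require Export complex.
Set Implicit Arguments.
Unset Strict Implicit.
Unset Printing Implicit Defensive.
Export Order.TTheory GRing.Theory Num.Theory.
Export numFieldNormedType.Exports.
Local Open Scope ring_scope.
Local Open Scope complex_scope.

(* The pair (hol, anti) = (h, g) is part of the data of f = h + conj g: it is
   determined by f only up to (h + c, g - conj c), and the fixed points at
   infinity depend on the choice. Degree at least 2 is size at least 3. *)
Record polyHarmonic (R : realType) := PolyHarmonic {
  hol : {poly R[i]};
  anti : {poly R[i]};
  hol_degree : (2 < size hol)%N;
  anti_degree : (2 < size anti)%N
}.

Definition polyHarmonic_fun (R : realType) (f : polyHarmonic R) (z : R[i]) : R[i] :=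
  (hol f).[z] + Num.conj (anti f).[z].

Coercion polyHarmonic_fun : polyHarmonic >-> Funclass.

(* Riemann sphere, with None as the point at infinity. *)
Definition sphere (R : realType) := option R[i].

Definition sphere_map (R : realType) (p : {poly R[i]}) (x : sphere R) : sphere R :=
  match x with
  | Some z => Some p.[z]
  | None => if (size p <= 1)%N then Some p`_0 else None
  end.

(* The point mu + conj omega is encoded by the pair (mu, omega): the multipliers
   depend on mu and omega, not only on their (possibly formal) sum. In the finite
   case only the sum is required to be preserved; mu and omega need not be fixed
   by h and g separately. *)
Definition hfixed (R : realType) (f : polyHarmonic R) (mu omega : sphere R) : Prop :=
  match mu, omega with
  | Some m, Some w =>
      m + Num.conj w = (hol f).[m] + Num.conj (anti f).[w]
  | _, _ =>
      sphere_map (hol f) mu = mu /\ sphere_map (anti f) omega = omega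
  end.

(* z |-> 1 / p(1/z), with the value 0 = 1 / p(oo) at z = 0 (p fixing infinity). *)
Definition at_infinity (R : realType) (p : {poly R[i]}) (z : R[i]) : R[i] :=
  if z == 0 then 0 else (p.[z^-1])^-1.

(* At infinity this is the complex derivative (limit of difference quotients
   over R[i]) of the map read in the chart 1/z. *)
Definition multiplier (R : realType) (p : {poly R[i]}) (x : sphere R) : R[i] :=
  match x with
  | Some z => (p^`()).[z]
  | None => derive1 (@at_infinity R p : R[i] -> R[i]^o) 0
  end.

(* Main.v *)
(** If the fixed points of a polynomial [h] of degree at least 2 are simple zeros
    [z_1, ..., z_d] of [h - 'X], then the sum of the [1 / (h'(z_i) - 1)] vanishes,
    so these numbers cannot all have negative real part, and some [h'(z_i)] has
    real part at least 1; a multiple zero has [h' = 1]. The sum vanishes because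
    it is the coefficient of degree [d - 1] in the Lagrange interpolation of the
    constant polynomial 1 at the zeros. A fixed point of [h] and one of [g]
    together form a finite h-fixed point. *)
Require Import Defs.
From mathcomp Require Import separable.
Local Open Scope ring_scope.

Lemma deriv_prod_XsubC_root (F : comNzRingType) (rs : seq F) (z : F) :
  z \in rs ->
  ((\prod_(w <- rs) ('X - w%:P))^`()).[z] =
  (\prod_(w <- rem z rs) ('X - w%:P)).[z].
Proof.
move=> zrs; rewrite (big_rem z zrs) /= derivM derivXsubC mul1r.
by rewrite hornerD hornerM hornerXsubC subrr mul0r addr0.
Qed.

Lemma sum_inv_deriv_prod_XsubC (F : fieldType) (rs : seq F) :
  uniq rs -> (1 < size rs)%N ->
  \sum_(z <- rs) (((\prod_(w <- rs) ('X - w%:P))^`()).[z])^-1 = 0.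
Proof.
move=> Urs rs_gt1; set p := \prod_(w <- rs) _.
pose P z := \prod_(w <- rem z rs) ('X - w%:P).
have sP z : z \in rs -> size (P z) = size rs.
  by move=> zrs; rewrite size_prod_XsubC size_rem // prednK // ltnW.
have P0 z w : w \in rs -> w != z -> (P z).[w] = 0.
  by move=> wrs wz; apply/rootP; rewrite root_prod_XsubC mem_rem_uniq // inE wz.
have Pz z : z \in rs -> (P z).[z] != 0.
  by move=> zrs; rewrite -rootE root_prod_XsubC mem_rem_uniq // inE eqxx.
(* Lagrange interpolation of 1: both sides agree at every point of [rs] and have degree below
   [size rs]. *)
have L1 : \sum_(z <- rs) (P z).[z]^-1 *: P z = 1.
  apply/eqP; rewrite -subr_eq0; apply/eqP.
  apply: (roots_geq_poly_eq0 (rs := rs)) => //.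
    apply/allP => w wrs; rewrite rootE hornerD hornerN hornerC horner_sum.
    rewrite (bigD1_seq w) //= hornerZ mulVf ?Pz // big1 ?addr0 ?subrr //.
    by move=> z zw; rewrite hornerZ (P0 z w) ?mulr0 // eq_sym.
  rewrite (leq_trans (size_polyD _ _)) // geq_max size_polyN size_poly1.
  rewrite (ltnW rs_gt1) andbT big_seq.
  apply: (leq_trans (size_sum _ _ _)); apply/bigmax_leqP_seq => z _ zrs.
  by rewrite (leq_trans (size_scale_leq _ _)) // sP.
(* In degree [(size rs).-1], which is positive, the constant 1 has coefficient 0, while each monic
   [P z] contributes its weight [(P z).[z]^-1]. *)
have /= := congr1 (fun q : {poly F} => q`_(size rs).-1) L1.
rewrite coef1 coef_sum gtn_eqF ?ltn_predRL //= => sum0; rewrite -[RHS]sum0.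
rewrite !big_seq; apply: eq_bigr => z zrs.
rewrite coefZ -(sP z zrs) -/(lead_coef _).
by rewrite (monicP (monic_prod_XsubC _ _ _)) mulr1 deriv_prod_XsubC_root.
Qed.

(** Inversion divides the real part by the positive number [|z|^2]. *)
Lemma Re_inv_lt0 (R : realType) (z : R[i]) :
  complex.Re z < 0 -> complex.Re z^-1 < 0.
Proof.
case: z => a b /= a_lt0.
by rewrite pmulr_llt0 // invr_gt0 ltr_wpDr ?sqr_ge0 // exprn_even_gt0 //= lt_eqF.
Qed.

Lemma root_Re_deriv_ge0 (R : realType) (q : {poly R[i]}) :
  (2 < size q)%N -> exists2 z, root q z & 0 <= complex.Re (q^`()).[z].
Proof.
move=> q_gt2; apply: contrapT => noz.
have Re_lt0 z : root q z -> complex.Re (q^`()).[z] < 0.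
  by move=> qz; rewrite ltNge; apply/negP => ?; apply: noz; exists z.
have [rs qE] := closed_field_poly_normal q.
set c := lead_coef q in qE; set p := \prod_(z <- rs) _ in qE.
have c0 : c != 0 by rewrite lead_coef_eq0 -size_poly_gt0 (leq_trans _ q_gt2).
have rootq z : root q z = (z \in rs) by rewrite qE rootZ // root_prod_XsubC.
have rs_gt1 : (1 < size rs)%N.
  by move: q_gt2; rewrite qE size_scale // size_prod_XsubC ltnS.
have Urs : uniq rs.
  rewrite -separable_prod_XsubC unlock; apply: contraT => /closed_rootP[z].
  rewrite root_gcd => /andP[pz /rootP p'z].
  have := Re_lt0 z; rewrite qE rootZ // derivZ hornerZ p'z mulr0 ltxx.
  by move=> /(_ pz).
have : \sum_(z <- rs) complex.Re ((q^`()).[z])^-1 = 0.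
  rewrite -(raddf_sum (@complex.Re R : Rcomplex R -> R)).
  rewrite (eq_bigr (fun z => c^-1 * ((p^`()).[z])^-1)); last first.
    by move=> z _; rewrite qE derivZ hornerZ invfM.
  by rewrite -mulr_sumr sum_inv_deriv_prod_XsubC // mulr0.
apply/eqP; rewrite lt_eqF // big_seq.
(* Zero becomes a sum over the same roots, for a termwise comparison; it is strict because [rs] is
   nonempty. *)
have E0 : \sum_(z <- rs | z \in rs) 0 = 0 :> R by rewrite big1.
rewrite -[ltRHS]E0.
apply: ltr_sum => [|z zrs]; last by rewrite Re_inv_lt0 ?Re_lt0 ?rootq.
by apply/hasP; exists rs`_0; rewrite /= mem_nth ?(ltnW rs_gt1).
Qed.

Lemma fixpoint_Re_deriv_ge1 (R : realType) (h : {poly R[i]}) :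
  (2 < size h)%N -> exists2 z, h.[z] = z & 1 <= complex.Re (h^`()).[z].
Proof.
move=> h_gt2; have [|z] := @root_Re_deriv_ge0 _ (h - 'X).
  by rewrite size_polyDl ?size_polyN ?size_polyX.
rewrite rootE derivB derivX !hornerE subr_eq0 => /eqP hz Re_ge0.
by exists z => //; move: Re_ge0; rewrite raddfB subr_ge0.
Qed.

Theorem theorem4 (R : realType) (f : polyHarmonic R) :
  exists mu omega : sphere R,
    hfixed f mu omega /\
    1 <= complex.Re (multiplier (hol f) mu) /\
    1 <= complex.Re (multiplier (anti f) omega).
Proof.
have [mu hmu Remu] := fixpoint_Re_deriv_ge1 _ _ (hol_degree f).
have [omega homega Reomega] := fixpoint_Re_deriv_ge1 _ _ (anti_degree f).
by exists (Some mu), (Some omega); rewrite /= hmu homega.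
Qed.
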